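(* Let $\circledast,\odot$ be proper multiplications on $\mathbb{Z}^d$. For every integer $r\geq 2$, the classes $\mathcal{IP}_r^*(\circledast)$ and $\mathcal{IP}_r^*(\odot)$ are equal if and only if $\circledast=\odot$ or $\circledast=\odot_{\mathrm{op}}$.
   Context: A proper multiplication on $\mathbb{Z}^d$ is a binary operation $\circledast:\mathbb{Z}^d\times\mathbb{Z}^d\to\mathbb{Z}^d$ that makes $(\mathbb{Z}^d,+)$ into an associative (not necessarily commutative or unital) ring without zero divisors; $\mathbb{Z}^d_{\neq 0}=\mathbb{Z}^d\setminus\{0\}$. The opposite operation is $x\odot_{\mathrm{op}}y=y\odot x$. For a semigroup $(S,\cdot)$ and $r\in\mathbb{N}$, a set $A\subseteq S$ is $\mathrm{IP}_r$ if there are $s_1,\dots,s_r\in S$ with $A\supseteq\{s_{i_1}\cdot s_{i_2}\cdots s_{i_k}: 1\le k\le r,\ i_1<\dots<i_k,\ \{i_1,\dots,i_k\}\subseteq\{1,\dots,r\}\}$ (products taken in increasing order of indices). $\mathcal{IP}_r^*(\circledast)$ is the class of subsets of $\mathbb{Z}^d_{\neq 0}$ having non-empty intersection with every $\mathrm{IP}_r$ subset of the semigroup $(\mathbb{Z}^d_{\neq 0},\circledast)$. *)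

(* Defs.v *)
From mathcomp Require Import all_boot all_order all_algebra.
From mathcomp Require Import boolp classical_sets.

Set Implicit Arguments.
Unset Strict Implicit.
Unset Printing Implicit Defensive.

Import GRing.Theory.

Local Open Scope classical_set_scope.
Local Open Scope ring_scope.

Section Semigroup.
Variable T : Type.

Definition opposite (op : T -> T -> T) : T -> T -> T := fun x y => op y x.

(* As [i :: l] is strictly increasing, it is an arbitrary non-empty subset
   i_1 < ... < i_k of the indices; [foldl] avoids the need for a unit. *)
Definition finite_products (op : T -> T -> T) (r : nat) (s : 'I_r -> T) :
    set T :=
  [set x | exists (i : 'I_r) (l : seq 'I_r),
    path (fun j k : 'I_r => (j < k)%N) i l /\
    x = foldl op (s i) [seq s j | j <- l]].

(* The semigroup is carried by the subset [S] of [T], closed under [op]. *)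
Definition IP (S : set T) (op : T -> T -> T) (r : nat) (A : set T) : Prop :=
  A `<=` S /\
  exists s : 'I_r -> T, (forall i, S (s i)) /\ finite_products op s `<=` A.

Definition IPstar (S : set T) (op : T -> T -> T) (r : nat) : set (set T) :=
  [set A | A `<=` S /\ forall B : set T, IP S op r B -> A `&` B !=set0].

End Semigroup.

Definition nonzero_vectors (d : nat) : set 'rV[int]_d := [set x | x <> 0].

Record proper_multiplication (d : nat)
    (mul : 'rV[int]_d -> 'rV[int]_d -> 'rV[int]_d) : Prop := {
  proper_mulA : associative mul;
  proper_mulDl : left_distributive mul +%R;
  proper_mulDr : right_distributive mul +%R;
  proper_mul_eq0 : forall x y, mul x y = 0 -> x = 0 \/ y = 0
}.

Definition IPstar_nonzero (d : nat)
    (mul : 'rV[int]_d -> 'rV[int]_d -> 'rV[int]_d) (r : nat) :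
    set (set 'rV[int]_d) :=
  IPstar (@nonzero_vectors d) mul r.

(* Main.v *)
From HB Require Import structures.
Require Import Defs.
From mathcomp Require Import all_boot all_order all_algebra.
From mathcomp Require Import boolp classical_sets cardinality.

(**
  A class of IP_r^* sets determines the class of IP_r sets of which it is the
  dual. The p-adic valuation of an integer vector, i.e. that of the gcd of its
  coordinates, is superadditive for every biadditive multiplication. Given
  nonzero u and v, multiply each term of the sequence u, v, u, ..., u by its own
  prime p_i, where the p_i do not divide any of the relevant products of u's and
  v's. A product of the resulting generators s_i for the first multiplication is
  determined by the set of the p_i dividing it, and has valuation 1 at these. If
  all the products of t_1, ..., t_r for the second multiplication are among
  them, superadditivity makes the sets of the p_i dividing t_1, ..., t_r
  pairwise disjoint, hence singletons: t is a rearrangement of s. Comparing the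
  products of s_1 and s_2 shows that the first product of u and v is the second
  product of u and v, or of v and u. As a group is never the union of two proper
  subgroups, the same alternative holds for all u and v.
*)

Set Implicit Arguments.
Unset Strict Implicit.
Unset Printing Implicit Defensive.

Import Order.TTheory GRing.Theory Num.Theory.

Local Open Scope classical_set_scope.
Local Open Scope ring_scope.

Local Notation increasing := (path (fun j k : 'I__ => (j < k)%N)).

Section FiniteProducts.
Variables (T : Type) (op : T -> T -> T) (r : nat).
Implicit Types (s : 'I_r -> T) (S A B : set T).

Lemma finite_products_gen s i : finite_products op s (s i).
Proof. by exists i, [::]. Qed.

Lemma finite_products_op s (i j : 'I_r) :
  (i < j)%N -> finite_products op s (op (s i) (s j)).
Proof. by move=> ij; exists i, [:: j]; rewrite /= ij. Qed.

Lemma increasing_uniq (i : 'I_r) l : increasing i l -> uniq (i :: l).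
Proof. exact: (@lt_sorted_uniq _ 'I_r (i :: l)). Qed.

Lemma finite_products_finite s : finite_set (finite_products op s).
Proof.
pose product (w : 'I_r * r.-bseq 'I_r) := foldl op (s w.1) (map s w.2).
apply: (@sub_finite_set _ _ (product @` setT)); last first.
  exact/finite_image/finite_finset.
move=> _ [i [l [/increasing_uniq/card_uniqP card_il ->]]].
have sl : (size l <= r)%N.
  by apply: ltnW; rewrite -[ltnRHS]card_ord -[leqLHS]card_il max_card.
by exists (i, Bseq sl).
Qed.

Lemma finite_products_sub S s :
  (forall x y, S x -> S y -> S (op x y)) -> (forall i, S (s i)) ->
  finite_products op s `<=` S.
Proof.
move=> S_op S_s _ [i [l [_ ->]]]; elim/last_ind: l => //= l j IHl.
by rewrite map_rcons foldl_rcons; apply: S_op.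
Qed.

Lemma IP_finite_products S s :
  (forall x y, S x -> S y -> S (op x y)) -> (forall i, S (s i)) ->
  IP S op r (finite_products op s).
Proof.
by move=> S_op S_s; split; [exact: finite_products_sub | exists s; split].
Qed.

Lemma IP_superset S A B : A `<=` B -> B `<=` S -> IP S op r A -> IP S op r B.
Proof.
by move=> AB BS [_ [s [sS sA]]]; split=> //; exists s; split=> // x /sA/AB.
Qed.

Lemma IPstar_setD S A : A `<=` S -> IPstar S op r (S `\` A) <-> ~ IP S op r A.
Proof.
move=> AS; split=> [[_ meets] IPA|nIPA].
  by have [x [[_ nAx] Ax]] := meets A IPA.
split=> [x []//|B IPB]; apply: contrapT => SAB0; apply: nIPA.
have [BS _] := IPB; apply: IP_superset IPB => // x Bx.
apply: contrapT => nAx; apply: SAB0; exists x.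
by split=> //; split=> //; apply: BS.
Qed.

End FiniteProducts.

Lemma IPstar_inj (T : Type) (S : set T) (op1 op2 : T -> T -> T) r :
  IPstar S op1 r = IPstar S op2 r -> IP S op1 r = IP S op2 r.
Proof.
move=> eq_star; apply/funext => A.
have [AS|nAS] := pselect (A `<=` S); last by apply/propext; split=> -[].
apply: (can_inj notK).
by rewrite -!(propext (IPstar_setD _ _ AS)) eq_star.
Qed.

Lemma foldl_foldr (T : Type) (op : T -> T -> T) a l :
  associative op -> foldl op a l = foldr op (last a l) (belast a l).
Proof.
move=> opA; suff op_foldl b c s : op b (foldl op c s) = foldl op (op b c) s.
  by elim: l a => //= b l IHl a; rewrite -IHl op_foldl.
by elim: s c => //= e s IHs c; rewrite IHs opA.
Qed.

Section Opposite.
Variables (T : Type) (op : T -> T -> T).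
Hypothesis opA : associative op.

Lemma opposite_assoc : associative (opposite op).
Proof. by move=> x y z; rewrite /opposite opA. Qed.

Lemma foldl_opposite a l :
  foldl (opposite op) a l = foldl op (last a l) (rev (belast a l)).
Proof. by rewrite foldl_rev (foldl_foldr _ _ opposite_assoc). Qed.

Lemma finite_products_opposite r (s : 'I_r -> T) :
  finite_products (opposite op) (s \o @rev_ord r) `<=` finite_products op s.
Proof.
move=> _ [i [l [il ->]]].
exists (rev_ord (last i l)), (map (@rev_ord r) (rev (belast i l))); split.
  rewrite path_map rev_path; apply: sub_path il => j k jk /=.
  by rewrite ltn_sub2l // (leq_ltn_trans jk).
by rewrite foldl_opposite belast_map last_map -map_rev -map_comp.
Qed.

Lemma IP_opposite (S : set T) r A : IP S op r A -> IP S (opposite op) r A.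
Proof.
move=> [AS [s [sS sA]]]; split=> //; exists (s \o @rev_ord r); split=> [i|].
  exact: sS.
exact: subset_trans (@finite_products_opposite _ s) sA.
Qed.

End Opposite.

Lemma IPstar_opposite (T : Type) (S : set T) (op : T -> T -> T) r :
  associative op -> IPstar S (opposite op) r = IPstar S op r.
Proof.
move=> opA; rewrite /IPstar; suff -> : IP S (opposite op) r = IP S op r by [].
apply/funext => A; apply/propext; split; last exact: IP_opposite.
exact/IP_opposite/opposite_assoc.
Qed.

Lemma disjoint_nonempty_singletons (T : finType) (F : T -> {set T}) :
  (forall i, (0 < #|F i|)%N) ->
  (forall i j c, c \in F i -> c \in F j -> i = j) ->
  exists2 h : T -> T, bijective h & forall i, F i = [set h i]%SET.
Proof.
move=> F_gt0 F_disjoint.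
have /choice[h hF] i : exists c, c \in F i by apply/card_gt0P.
have [g gK hK] : bijective h.
  apply: injF_bij => i j hij.
  by apply: (F_disjoint i j (h i)); [|rewrite hij]; exact: hF.
exists h => [|i]; first by exists g.
apply/setP => c; rewrite inE; apply/idP/eqP => [ci|-> //].
rewrite -(hK c); congr h; apply: (F_disjoint _ _ c) => //.
by rewrite -{1}(hK c).
Qed.

Lemma exists_primes_above (m : nat) :
  exists2 p : nat -> nat, injective p & forall n, prime (p n) /\ (m < p n)%N.
Proof.
pose next k := s2val (prime_above k).
have next_gt k : (k < next k)%N by rewrite /next; case: prime_above.
have next_prime k : prime (next k) by rewrite /next; case: prime_above.
pose p n := iter n.+1 next m.
have p_incr : {homo p : k n / (k < n)%N}.
  by apply: homo_ltn => [|n]; [exact: ltn_trans | exact: next_gt].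
exists p => [k n pkn|n].
  by case: (ltngtP k n) => // /p_incr; rewrite pkn ltnn.
split; first exact: next_prime.
by elim: n => [|n IHn]; [exact: next_gt | exact: ltn_trans IHn (next_gt _)].
Qed.

Lemma logn_prod_primes (I : eqType) (p : I -> nat) (i : I) (l : seq I) :
  injective p -> (forall j, prime (p j)) ->
  logn (p i) (\prod_(j <- l) p j) = count_mem i l.
Proof.
move=> p_inj p_prime; elim: l => [|j l IHl]; first by rewrite big_nil logn1.
rewrite big_cons lognM ?prodn_gt0 ?prime_gt0 // => [|k]; last exact: prime_gt0.
by rewrite IHl logn_prime // (inj_eq p_inj) eq_sym.
Qed.

Section Biadditive.
Variable V : zmodType.
Implicit Type op : V -> V -> V.

Definition biadditive op :=
  left_distributive op +%R /\ right_distributive op +%R.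

Lemma biadditive_zmod_morphism op y : biadditive op -> zmod_morphism (op^~ y).
Proof.
by move=> [opDl _] u v; apply: (addIr (op v y)); rewrite -opDl !subrK.
Qed.

Definition left_additive op (op_add : biadditive op) (y : V) :
    {additive V -> V} :=
  HB.pack (op^~ y) (GRing.isZmodMorphism.Build V V (op^~ y)
    (biadditive_zmod_morphism y op_add)).

Lemma biadditive_opposite op : biadditive op -> biadditive (opposite op).
Proof. by move=> [opDl opDr]; split=> x y z; rewrite /opposite ?opDl ?opDr. Qed.

Variable op : V -> V -> V.
Hypothesis op_add : biadditive op.

Lemma biadditive0l y : op 0 y = 0.
Proof. exact: (raddf0 (left_additive op_add y)). Qed.

Lemma biadditive0r x : op x 0 = 0.
Proof. exact: (raddf0 (left_additive (biadditive_opposite op_add) x)). Qed.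

Lemma biadditiveBl x y z : op (x - y) z = op x z - op y z.
Proof. exact: (raddfB (left_additive op_add z)). Qed.

Lemma biadditiveBr x y z : op x (y - z) = op x y - op x z.
Proof. exact: (raddfB (left_additive (biadditive_opposite op_add) x)). Qed.

Lemma biadditiveMn x y m n : op (x *+ m) (y *+ n) = op x y *+ (m * n).
Proof.
rewrite mulnC mulrnA; transitivity (op x (y *+ n) *+ m).
  exact: (raddfMn (left_additive op_add (y *+ n))).
congr (_ *+ m); exact: (raddfMn (left_additive (biadditive_opposite op_add) x)).
Qed.

Lemma foldl_biadditiveMn (I : Type) (p : I -> nat) (x : I -> V) i l :
  foldl op (x i *+ p i) [seq x j *+ p j | j <- l] =
  foldl op (x i) (map x l) *+ \prod_(j <- i :: l) p j.
Proof.
elim/last_ind: l => [|l j IHl]; first by rewrite big_seq1.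
rewrite !map_rcons !foldl_rcons IHl biadditiveMn.
by rewrite -rcons_cons -cats1 big_cat big_seq1.
Qed.

End Biadditive.

Lemma subgroup_cover (V : zmodType) (P Q : V -> Prop) :
  (forall x y, P x -> P y -> P (x - y)) ->
  (forall x y, Q x -> Q y -> Q (x - y)) ->
  (forall x, P x \/ Q x) -> (forall x, P x) \/ (forall x, Q x).
Proof.
move=> PB QB PQ; apply: contrapT => /not_orP[/existsNP[a Pa] /existsNP[b Qb]].
have Pb : P b by case: (PQ b).
have Qa : Q a by case: (PQ a).
case: (PQ (a + b)) => [Pab|Qab].
  by apply: Pa; rewrite -(addrK b a); apply: PB.
by apply: Qb; rewrite -(addrK a b) [b + a]addrC; apply: QB.
Qed.

Lemma biadditive_eq_or_opposite (V : zmodType) (op1 op2 : V -> V -> V) :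
  biadditive op1 -> biadditive op2 ->
  (forall u v, op1 u v = op2 u v \/ op1 u v = op2 v u) ->
  op1 = op2 \/ op1 = opposite op2.
Proof.
move=> add1 add2 op12.
have [||u|eq_op|eq_opp] := @subgroup_cover _
  (fun u => forall v, op1 u v = op2 u v) (fun u => forall v, op1 u v = op2 v u).
- by move=> x y eqx eqy v; rewrite !biadditiveBl // eqx eqy.
- by move=> x y eqx eqy v; rewrite biadditiveBl // biadditiveBr // eqx eqy.
- apply: subgroup_cover => // x y eqx eqy.
    by rewrite !biadditiveBr // eqx eqy.
  by rewrite biadditiveBr // biadditiveBl // eqx eqy.
- by left; apply/funext => u; apply/funext.
- by right; apply/funext => u; apply/funext => v; rewrite eq_opp.
Qed.

Lemma mulmxn_inj (R : numDomainType) m n k :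
  (0 < k)%N -> injective (fun A : 'M[R]_(m, n) => A *+ k).
Proof.
move=> k_gt0 A B /=; rewrite -!scaler_nat; apply: scalemx_inj.
by rewrite pnatr_eq0 -lt0n.
Qed.

Section Valuation.
Variable d : nat.
Implicit Types (v : 'rV[int]_d) (n p : nat).

Definition content v : nat := (\big[gcdn/0]_j `|v ord0 j|)%N.

(* Junk value: [valuation p 0] is [0] rather than infinite. *)
Definition valuation p v : nat := logn p (content v).

Lemma dvdn_contentP n v : reflect (exists w, v = w *+ n) (n %| content v)%N.
Proof.
apply: (iffP (dvdn_biggcdP _ _ _)) => [nv|[w -> j _]]; last first.
  by rewrite mulmxnE -mulr_natr abszM natz dvdn_mull.
exists (\row_j (v ord0 j %/ n%:Z)%Z); apply/rowP => j.
by rewrite mulmxnE mxE -mulr_natr natz divzK // dvdzE nv.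
Qed.

Lemma content_mulrn v n : content (v *+ n) = (content v * n)%N.
Proof.
rewrite /content (big_morph (muln^~ n) (fun a b => muln_gcdl a b n) (mul0n n)).
by apply: eq_bigr => j _; rewrite mulmxnE -mulr_natr abszM natz.
Qed.

Lemma content_gt0 v : v <> 0 -> (0 < content v)%N.
Proof.
move=> v0; rewrite lt0n; apply/eqP => cv0.
by have /dvdn_contentP[w] : (0 %| content v)%N; rewrite ?cv0 // mulr0n.
Qed.

Lemma valuation_mulrn p v n :
  v <> 0 -> (0 < n)%N -> valuation p (v *+ n) = (valuation p v + logn p n)%N.
Proof.
by move=> v0 n0; rewrite /valuation content_mulrn lognM ?content_gt0.
Qed.

Lemma valuation_biadditive p (op : 'rV[int]_d -> 'rV[int]_d -> 'rV[int]_d) u v :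
  biadditive op -> op u v <> 0 ->
  (valuation p u + valuation p v <= valuation p (op u v))%N.
Proof.
move=> op_add /content_gt0 opuv_gt0.
have uv_dvd : (content u * content v %| content (op u v))%N.
  have /dvdn_contentP[u' {2}->] := dvdnn (content u).
  have /dvdn_contentP[v' {2}->] := dvdnn (content v).
  by rewrite biadditiveMn // content_mulrn dvdn_mull.
have : (0 < content u * content v)%N by apply: dvdn_gt0 uv_dvd.
rewrite muln_gt0 => /andP[u_gt0 v_gt0].
by rewrite /valuation -lognM // dvdn_leq_log.
Qed.

Lemma exists_primes_valuation0 (X : set 'rV[int]_d) :
  finite_set X ->
  exists2 p : nat -> nat, injective p &
    forall n, prime (p n) /\ forall v, X v -> valuation (p n) v = 0%N.
Proof.
move=> /finite_seqP[s ->].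
have [p p_inj p_big] := exists_primes_above (\max_(v <- s) content v).
exists p => // n; have [p_prime p_gt] := p_big n; split=> // v vs.
by apply: ltn_log0; apply: leq_ltn_trans p_gt; apply: leq_bigmax_seq.
Qed.

End Valuation.

Definition prime_support d r (p : 'I_r -> nat) (v : 'rV[int]_d) : {set 'I_r} :=
  [set k | (0 < valuation (p k) v)%N]%SET.

Lemma proper_biadditive d (mul : 'rV[int]_d -> 'rV[int]_d -> 'rV[int]_d) :
  proper_multiplication mul -> biadditive mul.
Proof. by case. Qed.

Lemma proper_mul_neq0 d (mul : 'rV[int]_d -> 'rV[int]_d -> 'rV[int]_d) :
  proper_multiplication mul -> forall x y,
  nonzero_vectors x -> nonzero_vectors y -> nonzero_vectors (mul x y).
Proof. by move=> mul_proper x y x0 y0 /(proper_mul_eq0 mul_proper)[]. Qed.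

Section PrimeMultiples.
Variables (d : nat) (mul : 'rV[int]_d -> 'rV[int]_d -> 'rV[int]_d).
Hypothesis mul_proper : proper_multiplication mul.
Variables (r : nat) (p : 'I_r -> nat) (x : 'I_r -> 'rV[int]_d).
Hypotheses (p_inj : injective p) (p_prime : forall i, prime (p i)).
Hypothesis x_neq0 : forall i, nonzero_vectors (x i).
Hypothesis valuation_products_x :
  forall k v, finite_products mul x v -> valuation (p k) v = 0%N.

Local Notation s := (fun i => x i *+ p i).

Lemma prime_multiple_neq0 i : nonzero_vectors (s i).
Proof.
move=> si0; apply: (x_neq0 (i := i)).
by apply: (mulmxn_inj (prime_gt0 (p_prime i))); rewrite /= si0 mul0rn.
Qed.

Lemma finite_products_neq0 v : finite_products mul s v -> v <> 0.
Proof.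
exact: finite_products_sub (proper_mul_neq0 mul_proper) prime_multiple_neq0 v.
Qed.

Lemma valuation_foldl k (i : 'I_r) l : increasing i l ->
  valuation (p k) (foldl mul (s i) (map s l)) = (k \in i :: l).
Proof.
move=> il; have xil : finite_products mul x (foldl mul (x i) (map x l)).
  by exists i, l.
have xil_neq0 := finite_products_sub (proper_mul_neq0 mul_proper) x_neq0 xil.
rewrite foldl_biadditiveMn; last exact: proper_biadditive.
rewrite valuation_mulrn ?prodn_gt0 // => [|j]; last exact: prime_gt0.
rewrite valuation_products_x // logn_prod_primes // count_uniq_mem //.
exact: increasing_uniq.
Qed.

Lemma prime_support_foldl (i : 'I_r) l : increasing i l ->
  prime_support p (foldl mul (s i) (map s l)) =i i :: l.
Proof. by move=> il k; rewrite inE valuation_foldl // lt0b. Qed.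

Lemma valuation_finite_products k v :
  finite_products mul s v -> valuation (p k) v = (k \in prime_support p v).
Proof.
by move=> [i [l [il ->]]]; rewrite prime_support_foldl // valuation_foldl.
Qed.

Lemma card_prime_support_gt0 v :
  finite_products mul s v -> (0 < #|prime_support p v|)%N.
Proof.
move=> [i [l [il ->]]]; apply/card_gt0P; exists i.
by rewrite prime_support_foldl // mem_head.
Qed.

Lemma prime_support_inj v w :
  finite_products mul s v -> finite_products mul s w ->
  prime_support p v = prime_support p w -> v = w.
Proof.
move=> [i [l [il ->]]] [j [m [jm ->]]] eq_support.
have [-> -> //] : i :: l = j :: m.
apply: (@lt_sorted_eq _ 'I_r) => // k.
by rewrite -!prime_support_foldl // eq_support.
Qed.

Variable mul2 : 'rV[int]_d -> 'rV[int]_d -> 'rV[int]_d.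
Hypothesis mul2_add : biadditive mul2.

Lemma generators_rearrangement (t : 'I_r -> 'rV[int]_d) :
  finite_products mul2 t `<=` finite_products mul s ->
  exists2 h : 'I_r -> 'I_r, bijective h & forall i, t i = s (h i).
Proof.
move=> ts.
have t_fp i : finite_products mul s (t i) by apply/ts/finite_products_gen.
have disjoint_lt (i j : 'I_r) c : (i < j)%N ->
    c \in prime_support p (t i) -> c \in prime_support p (t j) -> False.
  move=> ij ci cj; have tij_fp := ts _ (finite_products_op mul2 t ij).
  have := valuation_biadditive (p c) mul2_add (finite_products_neq0 tij_fp).
  by rewrite !valuation_finite_products // ci cj; case: (c \in _).
have [i|i j c ci cj|h h_bij support_t] :=
    @disjoint_nonempty_singletons _ (fun i => prime_support p (t i)).
- exact: card_prime_support_gt0.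
- apply/val_inj; case: (ltngtP i j) => // [ij|ji].
    by case: (disjoint_lt _ _ _ ij ci cj).
  by case: (disjoint_lt _ _ _ ji cj ci).
exists h => // i; apply: prime_support_inj => //.
  exact: finite_products_gen.
rewrite support_t; apply/setP => k.
by rewrite (@prime_support_foldl (h i) [::]) // !inE.
Qed.

Lemma mul_eq_of_finite_products (a b i j : 'I_r) :
  (a < b)%N -> perm_eq [:: i; j] [:: a; b] ->
  (forall k, valuation (p k) (mul2 (x i) (x j)) = 0%N) ->
  finite_products mul s (mul2 (s i) (s j)) ->
  mul (x a) (x b) = mul2 (x i) (x j).
Proof.
move=> ab ij_ab valuation_ij sij_fp.
have prod_gt0 : (0 < \prod_(k <- [:: i; j]) p k)%N.
  by apply: prodn_gt0 => k; exact: prime_gt0.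
have mul_s := foldl_biadditiveMn (proper_biadditive mul_proper) p x a [:: b].
have mul2_s := foldl_biadditiveMn mul2_add p x i [:: j].
rewrite -(perm_big _ ij_ab) /= in mul_s; rewrite /= in mul2_s.
have mul2_neq0 : mul2 (x i) (x j) <> 0.
  by move=> m0; apply: (finite_products_neq0 sij_fp); rewrite mul2_s m0 mul0rn.
apply: (mulmxn_inj prod_gt0); rewrite /= -mul_s -mul2_s.
apply: prime_support_inj => //; first exact: finite_products_op.
apply/setP => k; rewrite (@prime_support_foldl a [:: b]) /= ?ab //.
rewrite -(perm_mem ij_ab) [RHS]inE mul2_s valuation_mulrn //.
by rewrite valuation_ij logn_prod_primes // add0n -has_count has_pred1.
Qed.

Lemma IP_mul_eq_or_swap (a b : 'I_r) :
  (a < b)%N ->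
  (forall k, valuation (p k) (mul2 (x a) (x b)) = 0%N) ->
  (forall k, valuation (p k) (mul2 (x b) (x a)) = 0%N) ->
  IP (@nonzero_vectors d) mul2 r (finite_products mul s) ->
  mul (x a) (x b) = mul2 (x a) (x b) \/ mul (x a) (x b) = mul2 (x b) (x a).
Proof.
move=> ab valuation_ab valuation_ba [_ [t [_ ts]]].
have [h [g gK hK] tE] := generators_rearrangement ts.
have t_mul (i j : 'I_r) :
    (g i < g j)%N -> finite_products mul s (mul2 (s i) (s j)).
  by move=> /(finite_products_op mul2 t)/ts; rewrite !tE !hK.
case: (ltngtP (g a) (g b)) => [/t_mul|/t_mul|/val_inj/(can_inj hK) eq_ab].
- by left; apply: mul_eq_of_finite_products.
- right; apply: mul_eq_of_finite_products => //.
  exact/permPl/(perm_catC [:: b] [:: a]).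
- by rewrite eq_ab ltnn in ab.
Qed.

End PrimeMultiples.

Lemma IPstar_mul_eq_or_swap (d : nat)
    (mul1 mul2 : 'rV[int]_d -> 'rV[int]_d -> 'rV[int]_d) (r : nat) :
  proper_multiplication mul1 -> proper_multiplication mul2 -> (2 <= r)%N ->
  IPstar_nonzero mul1 r = IPstar_nonzero mul2 r ->
  forall u v, mul1 u v = mul2 u v \/ mul1 u v = mul2 v u.
Proof.
move=> mul1_proper mul2_proper r_ge2 eq_star u v.
have add1 := proper_biadditive mul1_proper.
have add2 := proper_biadditive mul2_proper.
have [->|/eqP u_neq0] := eqVneq u 0; first by left; rewrite !biadditive0l.
have [->|/eqP v_neq0] := eqVneq v 0; first by left; rewrite !biadditive0r.
pose a : 'I_r := Ordinal (ltnW r_ge2); pose b : 'I_r := Ordinal r_ge2.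
pose x (i : 'I_r) := if i == b then v else u.
have x_neq0 i : nonzero_vectors (x i) by rewrite /x; case: ifP.
have X_finite :
    finite_set (finite_products mul1 x `|` [set mul2 u v; mul2 v u]).
  rewrite finite_setU; split; last exact: finite_set2.
  exact: finite_products_finite.
have [q q_inj q_primes] := exists_primes_valuation0 X_finite.
pose p (i : 'I_r) := q i.
have p_inj : injective p by move=> i j /q_inj/val_inj.
have p_prime i : prime (p i) by case: (q_primes i).
have valuation_X k w : finite_products mul1 x w \/ [set mul2 u v; mul2 v u] w ->
    valuation (p k) w = 0%N by case: (q_primes k) => _; exact.
apply: (IP_mul_eq_or_swap mul1_proper p_inj p_prime x_neq0 _ add2
  (a := a) (b := b)) => //.
- by move=> k w w_fp; apply: valuation_X; left.
- by move=> k; apply: valuation_X; right; left.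
- by move=> k; apply: valuation_X; right; right.
rewrite -(IPstar_inj eq_star); apply: IP_finite_products.
  exact: proper_mul_neq0.
exact: prime_multiple_neq0.
Qed.

Local Close Scope ring_scope.
Local Close Scope classical_set_scope.

Theorem theoremB (d : nat)
    (mul1 mul2 : 'rV[int]_d -> 'rV[int]_d -> 'rV[int]_d)
    (Hmul1 : proper_multiplication mul1) (Hmul2 : proper_multiplication mul2)
    (r : nat) (Hr : 2 <= r) :
  IPstar_nonzero mul1 r = IPstar_nonzero mul2 r <->
  mul1 = mul2 \/ mul1 = opposite mul2.
Proof.
split=> [eq_star|[->//|->]]; last exact: IPstar_opposite (proper_mulA Hmul2).
apply: biadditive_eq_or_opposite; [exact: proper_biadditive..|].
exact: IPstar_mul_eq_or_swap eq_star.
Qed.
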